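(* Let $R$ be a finite Frobenius ring, let $m\ge1$, let $C$ be a left $R$-linear code of length $n$ with right dual code $C^\perp$, and let $f\in\mathrm{Harm}_d(n)$. Then $$Z^{[m]}_{C^\perp,f}(x,y)=\sum_{\substack{X\subseteq E,\\ d\le|X|\le n-d}}\widetilde f(X)\,(|R|^m)^{d-\alpha_C(X)}\,(x-y)^{|E-X|-d}\,(|R|^m y)^{|X|-d}.$$
   Context: Let $E=\{1,\dots,n\}$, let $0\le d\le n$, and let $E_d$ be the set of $d$-element subsets of $E$. $\mathbb{R}E_d$ is the real vector space with basis $E_d$; its elements $f=\sum_{Z\in E_d}f(Z)Z$ are identified with functions $E_d\to\mathbb{R}$. The linear map $\gamma$ on $\mathbb{R}E_d$ is given by $\gamma(Z)=\sum_{Y\in E_{d-1},\,Y\subseteq Z}Y$ for $Z\in E_d$ (and $\gamma=0$ if $d=0$), and $\mathrm{Harm}_d(n)=\ker(\gamma|_{\mathbb{R}E_d})$. For $f\in\mathbb{R}E_d$ and $X\subseteq E$ put $\widetilde f(X)=\sum_{Z\in E_d,\,Z\subseteq X}f(Z)$. Rings are associative with identity, and $R$ is nonzero. A finite ring $R$ is Frobenius if $R/\mathrm{Rad}(R)\cong\mathrm{Soc}(R_R)$ as right $R$-modules and $R/\mathrm{Rad}(R)\cong\mathrm{Soc}({}_RR)$ as left $R$-modules, where $\mathrm{Rad}$ is the Jacobson radical and $\mathrm{Soc}$ the socle. A left (right) $R$-linear code of length $n$ is a left (right) $R$-submodule of $R^n$. With $\mathbf{u}\cdot\mathbf{v}=\sum_i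 u_iv_i$, the right dual code of a left $R$-linear code $C$ is $C^\perp=\{\mathbf{u}\in R^n:\mathbf{v}\cdot\mathbf{u}=0\text{ for all }\mathbf{v}\in C\}$, a right $R$-linear code. The support of $\mathbf{u}\in R^n$ is $\mathrm{supp}(\mathbf{u})=\{i\in E: u_i\ne 0\}$. For $Y\subseteq E$, the punctured code $C\backslash Y$ is obtained by deleting the coordinates in $Y$ from every codeword of $C$. Define $\alpha_C(X)=\log_{|R|}|C\backslash(E-X)|$ for $X\subseteq E$. For a left or right $R$-linear code $B$ of length $n$ and $X\subseteq E$, let $A^{[m]}_B(X)$ be the number of $(\mathbf{u}_1,\dots,\mathbf{u}_m)\in B^m$ with $\mathrm{supp}(\mathbf{u}_1)\cup\dots\cup\mathrm{supp}(\mathbf{u}_m)=X$. The $m$-tuple harmonic weight enumerator of $B$ associated to $f\in\mathrm{Harm}_d(n)$ is $W^{[m]}_{B,f}(x,y)=\sum_{X\subseteq E}\widetilde f(X)A^{[m]}_B(X)x^{|E-X|}y^{|X|}$. It is known that $\widetilde f(X)=0$ when $|X|<d$ or $|X|>n-d$, and $Z^{[m]}_{B,f}$ denotes the polynomial with $W^{[m]}_{B,f}(x,y)=(xy)^dZ^{[m]}_{B,f}(x,y)$, i.e. $$Z^{[m]}_{B,f}(x,y)=\sum_{\substack{X\subseteq E,\\ d\le|X|\le n-d}}\widetilde f(X)A^{[m]}_B(X)x^{|E-X|-d}y^{|X|-d}.$$ *)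

(* Defs.v *)
From HB Require Import structures.
From mathcomp Require Import all_boot all_order all_algebra.
From mathcomp Require Import polyXY ring_quotient.
From mathcomp Require Import reals exp.

Set Implicit Arguments.
Unset Strict Implicit.
Unset Printing Implicit Defensive.

Import Order.TTheory GRing.Theory Num.Theory.
Local Open Scope ring_scope.
Local Open Scope quotient_scope.

Section FrobeniusRing.
Variable R : finNzRingType.

Definition left_ideal (I : {set R}) : bool :=
  [&& 0 \in I, [forall x in I, forall y in I, x - y \in I]
    & [forall a, forall x in I, a * x \in I]].

Definition right_ideal (I : {set R}) : bool :=
  [&& 0 \in I, [forall x in I, forall y in I, x - y \in I]
    & [forall a, forall x in I, x * a \in I]].

Definition maximal_left_ideal (M : {set R}) : bool :=
  maxset (fun I => left_ideal I && (I != [set: R])) M.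

(* The simple submodules of _R R and of R_R are the minimal nonzero left,
   respectively right, ideals. *)
Definition minimal_left_ideal (I : {set R}) : bool :=
  minset (fun J => left_ideal J && (J != [set 0])) I.

Definition minimal_right_ideal (I : {set R}) : bool :=
  minset (fun J => right_ideal J && (J != [set 0])) I.

Definition jacobson_radical : {pred R} :=
  [pred x | [forall M, maximal_left_ideal M ==> (x \in M)]].

(* The socle is the sum of all simple submodules: the elements
   x = \sum_I g I, I running over the simple submodules, with g I \in I. *)
Definition left_socle : {set R} :=
  [set x | [exists g : {ffun {set R} -> R},
     [forall I, minimal_left_ideal I ==> (g I \in I)]
       && (x == \sum_(I | minimal_left_ideal I) g I)]].

Definition right_socle : {set R} :=
  [set x | [exists g : {ffun {set R} -> R},
     [forall I, minimal_right_ideal I ==> (g I \in I)]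
       && (x == \sum_(I | minimal_right_ideal I) g I)]].

Fact jacobson_radical_zmod_closed : zmod_closed jacobson_radical.
Proof.
split=> [|x y]; rewrite !inE.
  apply/forallP=> M; apply/implyP=> /maxsetp /andP[/and3P[M0 _ _] _].
  exact: M0.
move=> /forallP Hx /forallP Hy; apply/forallP=> M; apply/implyP=> HM.
have /andP[/and3P[_ /forall_inP HB _] _] := maxsetp HM.
exact: (forall_inP (HB x (implyP (Hx M) HM)) y (implyP (Hy M) HM)).
Qed.

HB.instance Definition _ :=
  GRing.isZmodClosed.Build R jacobson_radical jacobson_radical_zmod_closed.

Definition radical_quotient : zmodType :=
  Quotient.quot (jacobson_radical : zmodClosed R).

(* As the radical is a two-sided ideal, R / Rad(R) is a left and a right
   R-module, with a (x + Rad) = a x + Rad and (x + Rad) a = x a + Rad. *)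
Definition radical_quotient_iso_left_socle : Prop :=
  exists h : {additive radical_quotient -> R},
    [/\ forall a x : R, h (\pi_radical_quotient (a * x))
                        = a * h (\pi_radical_quotient x),
        injective h
      & forall y : R, y \in left_socle <-> exists q, h q = y].

Definition radical_quotient_iso_right_socle : Prop :=
  exists h : {additive radical_quotient -> R},
    [/\ forall a x : R, h (\pi_radical_quotient (x * a))
                        = h (\pi_radical_quotient x) * a,
        injective h
      & forall y : R, y \in right_socle <-> exists q, h q = y].

Definition frobenius_ring : Prop :=
  radical_quotient_iso_right_socle /\ radical_quotient_iso_left_socle.

End FrobeniusRing.

Section Codes.
Variables (R : finNzRingType) (n : nat).
Implicit Types (C B : {set 'rV[R]_n}) (X Y : {set 'I_n}).

Definition left_linear_code C : Prop := submod_closed (mem C).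

Definition dot (v u : 'rV[R]_n) : R := \sum_i v 0 i * u 0 i.

Definition right_dual C : {set 'rV[R]_n} :=
  [set u | [forall v in C, dot v u == 0]].

Definition supp (u : 'rV[R]_n) : {set 'I_n} := [set i | u 0 i != 0].

Definition puncture C Y : {set 'rV[R]_#|~: Y|} :=
  [set colsub (@enum_val _ (mem (~: Y))) u | u in C].

Definition alpha (K : realType) C X : K :=
  ln #|puncture C (~: X)|%:R / ln #|R|%:R.

Definition tuple_support_count (m : nat) B X : nat :=
  #|[set u : {ffun 'I_m -> 'rV[R]_n} |
      [forall i, u i \in B] && (\bigcup_i supp (u i) == X)]|.

End Codes.

Definition dsubset (n d : nat) := {Z : {set 'I_n} | #|Z| == d}.

Section Harmonic.
Variables (K : realType) (n d : nat).

(* The space R E_d; K^o is K seen as a module over itself. *)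
Definition dspace (e : nat) := {ffun dsubset n e -> K^o}.

Definition dbasis (e : nat) (Z : dsubset n e) : dspace e :=
  [ffun Y => (Y == Z)%:R].

(* For d = 0 the codomain, dspace 0.-1 = dspace 0, is a dummy. *)
Definition gamma_basis (Z : dsubset n d) : dspace d.-1 :=
  if d == 0%N then 0
  else \sum_(Y : dsubset n d.-1 | val Y \subset val Z) dbasis Y.

Definition gamma (f : dspace d) : dspace d.-1 :=
  \sum_(Z : dsubset n d) f Z *: gamma_basis Z.

Definition Harm : {pred dspace d} := [pred f | gamma f == 0].

Definition ftilde (f : dspace d) (X : {set 'I_n}) : K :=
  \sum_(Z : dsubset n d | val Z \subset X) f Z.

(* Z^[m]_{B,f}, as a polynomial in x = 'X and y = 'Y. *)
Definition harm_Z (R : finNzRingType) (m : nat) (B : {set 'rV[R]_n})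
    (f : dspace d) : {poly {poly K}} :=
  \sum_(X : {set 'I_n} | (d <= #|X| <= n - d)%N)
     (ftilde f X * (tuple_support_count m B X)%:R)%:P%:P
     * 'X ^+ (#|~: X| - d) * 'Y ^+ (#|X| - d).

End Harmonic.

Arguments Harm K n d : clear implicits.

(* Main.v *)
Require Import Defs.
From mathcomp Require Import all_boot all_order all_algebra.
From mathcomp Require Import zify ring.
From mathcomp Require Import ring_quotient polyXY reals exp.

Set Implicit Arguments.
Unset Strict Implicit.
Unset Printing Implicit Defensive.

Import Order.TTheory GRing.Theory Num.Theory.
Local Open Scope ring_scope.

(** The dual code enters only through the number of its words supported in a
    given [X], and the harmonic function only through the values of its lift
    [ftilde f] summed over the sets above a given [Y].

    Duality.  For every left linear [C] of length [n],
    [#|C^perp| * #|C| = #|R| ^ n] ([card_right_dual]).  The proof uses no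
    characters: for [N] inside [M] one shows
    [#|N^perp| * #|N| <= #|M^perp| * #|M|] ([card_dual_mono]); since both ends of
    the chain from the zero code to [R^n] give [#|R| ^ n], equality holds at [C].
    A chain with simple quotients reduces the inequality to
    [#|Hom(S, R)| <= #|S|] for a simple left module [S = R / M]
    ([card_rann_maximal]).  A morphism from [S] to [R] lands in the left socle,
    which is isomorphic to [R / Rad R] for a Frobenius ring, and
    [#|Hom(S, R / Rad R)| <= #|Hom(R / Rad R, S)| <= #|S|]: the first step holds
    because [R / Rad R] is a direct sum of simple modules and, by Schur's lemma,
    [#|Hom(S, S')| = #|Hom(S', S)|] for simple [S] and [S']; the second because a
    morphism on [R / Rad R] is determined by the image of the class of [1].

    Applied to the sum of [C] and the words vanishing on [X], the cardinality
    formula shows that the words of [C^perp] supported in [X] number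
    [#|R| ^ (#|X| - alpha X)] ([card_shortened_dual]).

    Harmonic sums.  From [gamma f = 0] one gets, for [#|Y| = j <= n - d],
    [\sum_(X | Y \subset X, #|X| = j + i) ftilde f X = 'C(n - d - j, i) ftilde f Y]
    ([Harm_sum_above_card]), and hence by the binomial theorem
    [\sum_(X | Y \subset X) ftilde f X (x - y)^(n - #|X| - d) y^(#|X| - d)
      = ftilde f Y x^(n - #|Y| - d) y^(#|Y| - d)], both [#|X|] and [#|Y|] being
    between [d] and [n - d] ([Harm_local_expansion]).

    In the right-hand side of the theorem, the factor
    [q^(d - alpha X) q^(#|X| - d)], with [q = #|R| ^ m], is therefore the number
    of [m]-tuples of words of [C^perp] supported in [X], that is the sum over
    [Y \subset X] of the numbers of [m]-tuples with joint support [Y].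
    Exchanging the two sums and applying the local expansion at each [Y] gives
    the enumerator of [C^perp]. *)

(** * Counting in finite abelian groups *)

Section Counting.
Variables (V W : finZmodType) (f : V -> W).
Hypothesis fB : zmod_morphism f.

Let fD : {morph f : x y / x + y}.
Proof.
have f0 : f 0 = 0 by rewrite -(subrr 0) fB subrr.
by move=> x y; rewrite -{1}[y]opprK -[- y]sub0r !fB f0 sub0r opprK.
Qed.

(** The homomorphism theorem for [(a, b) |-> f a + b] on [A * B], whose kernel
    projects bijectively onto the elements of [A] that [f] sends into [B].  It
    serves for kernels, intersections and sums of subgroups alike, without
    forming quotients. *)
Lemma card_additive_sum (A : {set V}) (B : {set W}) :
    zmod_closed (mem A) -> zmod_closed (mem B) ->
  (#|A| * #|B| = #|[set (f p.1 + p.2)%R | p in setX A B]|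
                 * #|[set a in A | f a \in B]|)%N.
Proof.
move=> [A0 AB] [B0 BB].
have AN a : a \in A -> - a \in A by move=> Aa; rewrite -sub0r; apply: AB.
have AD a a' : a \in A -> a' \in A -> a + a' \in A.
  by move=> Aa Aa'; rewrite -[a']opprK; apply: AB => //; apply: AN.
have BN b : b \in B -> - b \in B by move=> Bb; rewrite -sub0r; apply: BB.
have BD b b' : b \in B -> b' \in B -> b + b' \in B.
  by move=> Bb Bb'; rewrite -[b']opprK; apply: BB => //; apply: BN.
rewrite -cardsX -sum1_card.
rewrite (partition_big_imset (fun p : V * W => f p.1 + p.2)) /=.
rewrite -sum_nat_const; apply: eq_bigr => w /imsetP[[a0 b0]].
rewrite inE /= => /andP[Aa0 Bb0] ->.
rewrite sum1_card.
rewrite -(@card_imset _ _ (fun k => (a0 + k, b0 - f k))); last first.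
  by move=> k k' [/addrI].
apply: eq_card => -[a b]; rewrite [LHS]unfold_in /= inE /=; apply/andP/imsetP => /=.
  move=> [/andP[Aa Bb] /eqP e]; exists (a - a0).
    rewrite inE AB //= fB.
    have -> : f a - f a0 = b0 - b.
      by apply/eqP; rewrite subr_eq addrAC -subr_eq opprK e addrC.
    exact: BB.
  congr pair; first by rewrite addrC subrK.
  by rewrite fB opprB addrA [b0 + _]addrC -e [f a + b]addrC addrK.
move=> [k]; rewrite inE => /andP[Ak Bk] [-> ->].
split; first by rewrite AD //= BB.
by rewrite fD addrACA subrr addr0.
Qed.

Lemma card_additive_image (A : {set V}) : zmod_closed (mem A) ->
  (#|A| = #|f @: A| * #|[set a in A | f a == 0%R]|)%N.
Proof.
move=> cA; have c0 : zmod_closed (mem [set (0 : W)]).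
  by split=> [|x y]; rewrite !inE // => /eqP-> /eqP->; rewrite subr0.
have := card_additive_sum cA c0; rewrite cards1 muln1 => ->.
congr (_ * _)%N; apply: eq_card => w; last by rewrite !inE.
apply/imsetP/imsetP => [[[a b]]|[a Aa ->]].
  by rewrite !inE /= => /andP[Aa /eqP->] ->; exists a; rewrite ?addr0.
by exists (a, 0); rewrite ?inE ?Aa ?eqxx ?addr0.
Qed.

End Counting.

(** * Annihilators of maximal left ideals *)

Section Ideals.
Variable R : finNzRingType.
Implicit Types (I J L M : {set R}).

Lemma left_idealP I :
  reflect [/\ 0 \in I, {in I &, forall x y, x - y \in I}
            & forall a, {in I, forall x, a * x \in I}] (left_ideal I).
Proof.
apply: (iffP and3P) => -[I0 IB IM]; split=> //.
- by move=> x y Ix Iy; exact: (forall_inP (forall_inP IB x Ix) y Iy).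
- by move=> a x Ix; exact: (forall_inP (forallP IM a) x Ix).
- by apply/forall_inP => x Ix; apply/forall_inP => y Iy; exact: IB.
- by apply/forallP => a; apply/forall_inP => x Ix; exact: IM.
Qed.

Lemma left_ideal_zmod I : left_ideal I -> zmod_closed (mem I).
Proof. by case/left_idealP. Qed.

Lemma left_idealN I x : left_ideal I -> x \in I -> - x \in I.
Proof. by case/left_idealP=> I0 IB _ Ix; rewrite -sub0r; apply: IB. Qed.

Lemma left_idealD I x y : left_ideal I -> x \in I -> y \in I -> x + y \in I.
Proof.
move=> lI Ix Iy; rewrite -[y]opprK; have [_ IB _] := left_idealP _ lI.
by apply: IB => //; apply: left_idealN.
Qed.

Lemma left_ideal_eq_setT I : left_ideal I -> 1 \in I -> I = [set: R].
Proof.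
case/left_idealP=> _ _ IM I1; apply/setP => a.
by rewrite inE -[a]mulr1 IM.
Qed.

Lemma left_idealT : left_ideal [set: R].
Proof. by apply/left_idealP; split=> [|x y _ _|a x _]; rewrite inE. Qed.

Lemma left_idealI I J : left_ideal I -> left_ideal J -> left_ideal (I :&: J).
Proof.
move=> /left_idealP[I0 IB IM] /left_idealP[J0 JB JM]; apply/left_idealP.
split=> [|x y|a x]; rewrite !inE; first by rewrite I0.
- by move=> /andP[? ?] /andP[? ?]; rewrite IB ?JB.
- by move=> /andP[? ?]; rewrite IM ?JM.
Qed.

Lemma maximal_left_ideal_ideal M : maximal_left_ideal M -> left_ideal M.
Proof. by move=> /maxsetp/andP[]. Qed.

(** [R / M] is simple, so a nonzero [a] generates it. *)
Lemma maximal_left_ideal_inv M a :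
  maximal_left_ideal M -> a \notin M -> exists b, 1 - b * a \in M.
Proof.
move=> mM nMa; have lM := maximal_left_ideal_ideal mM.
have [M0 MB MM] := left_idealP _ lM.
pose I := [set p.1 * a + p.2 | p in setX [set: R] M].
have lI : left_ideal I.
  apply/left_idealP; split.
  - by apply/imsetP; exists (0, 0); rewrite ?inE // mul0r addr0.
  - move=> _ _ /imsetP[[b m] + ->] /imsetP[[b' m'] + ->].
    rewrite !inE /= => Mm Mm'.
    apply/imsetP; exists (b - b', m - m'); first by rewrite !inE MB.
    by rewrite mulrBl opprD addrACA.
  - move=> c _ /imsetP[[b m] + ->]; rewrite !inE /= => Mm.
    apply/imsetP; exists (c * b, c * m); first by rewrite !inE MM.
    by rewrite mulrDr mulrA.
have sMI : M \subset I.
  apply/subsetP => m Mm; apply/imsetP; exists (0, m); first by rewrite !inE.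
  by rewrite mul0r add0r.
have Ia : a \in I.
  by apply/imsetP; exists (1, 0); rewrite ?inE //= mul1r addr0.
have [/eqP eI|nI] := boolP (I == [set: R]).
  have : 1 \in I by rewrite eI inE.
  move=> /imsetP[[b m] + e]; rewrite !inE /= => Mm.
  by exists b; rewrite e /= addrC addKr.
have /maxsetP[_ /(_ I)] := mM; rewrite lI nI => /(_ isT sMI) eI.
by rewrite -eI Ia in nMa.
Qed.

(** [transporter I L] is the residual of left ideals: modulo [L] it is
    [Hom(R / I, R / L)], a morphism being given by the image of [1]. *)
Definition transporter I L : {set R} :=
  [set x | [forall a in I, a * x \in L]].

Lemma transporterP I L x :
  reflect {in I, forall a, a * x \in L} (x \in transporter I L).
Proof. by rewrite inE; apply: forall_inP. Qed.

Lemma transporter_zmod I L : left_ideal L -> zmod_closed (mem (transporter I L)).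
Proof.
case/left_idealP=> L0 LB LM; split=> [|x y].
  by apply/transporterP => a _; rewrite mulr0.
move=> /transporterP Tx /transporterP Ty; apply/transporterP => a Ia.
by rewrite mulrBr LB ?Tx ?Ty.
Qed.

(** Schur's lemma, as a count: between simple modules [S = R / M] and
    [S' = R / M'] there are as many morphisms one way as the other.  If
    [Hom(S, S')] contains a nonzero class [x0], composing with its inverse on
    both sides injects [Hom(S, S')] into [Hom(S', S)]. *)
Lemma card_hom_simple M M' : maximal_left_ideal M -> maximal_left_ideal M' ->
  (#|transporter M M'| * #|M| <= #|transporter M' M| * #|M'|)%N.
Proof.
move=> mM mM'.
have lM := maximal_left_ideal_ideal mM; have lM' := maximal_left_ideal_ideal mM'.
have [M0 MB MM] := left_idealP _ lM; have [M'0 M'B M'M] := left_idealP _ lM'.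
have [sT|/subsetPn[x0 Tx0 nx0]] := boolP (transporter M M' \subset M').
  rewrite mulnC leq_mul ?subset_leq_card //.
  apply/subsetP => x Mx; apply/transporterP => a _; exact: MM.
have /transporterP Hx0 := Tx0.
have [s0 Hs0] := maximal_left_ideal_inv mM' nx0.
(* Right multiplication by x0 is an injective morphism from R / M to R / M';
   right multiplication by s0 is its inverse, and g below maps a morphism x to
   the composite s0 x s0. *)
have inj_x0 a : a * x0 \in M' -> a \in M.
  move=> Ma; apply/negPn/negP => nMa.
  have [b Hb] := maximal_left_ideal_inv mM nMa.
  case/negP: nx0; have -> : x0 = (1 - b * a) * x0 + b * (a * x0).
    by rewrite mulrBl mul1r mulrA subrK.
  by apply: left_idealD => //; [apply: Hx0 | apply: M'M].
have Hs : 1 - x0 * s0 \in M.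
  apply: inj_x0; rewrite mulrBl mul1r -[x0 in x0 - _]mulr1 -mulrA -mulrBr.
  exact: M'M.
have inj_s0 a : a * s0 \in M -> a \in M'.
  move=> Ma; have -> : a = a * (1 - s0 * x0) + (a * s0) * x0.
    by rewrite mulrBr mulr1 mulrA subrK.
  by apply: left_idealD => //; [apply: M'M | apply: Hx0].
have Ts0 a : a \in M' -> a * s0 \in M.
  move=> Ma; apply: inj_x0.
  have -> : a * s0 * x0 = a - a * (1 - s0 * x0).
    by rewrite mulrBr mulr1 mulrA subKr.
  by apply: M'B => //; apply: M'M.
pose g x := s0 * x * s0.
have gB : zmod_morphism g by move=> x y; rewrite /g mulrBr mulrBl.
rewrite (card_additive_sum gB (transporter_zmod _ lM') (left_ideal_zmod lM)).
apply: leq_mul; apply: subset_leq_card; apply/subsetP => x.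
  case/imsetP=> -[a b]; rewrite in_setX /= => /andP[/transporterP Ta Mb] ->.
  apply/transporterP => c Mc; rewrite mulrDr; apply: left_idealD => //=; last exact: MM.
  by rewrite /g !mulrA; apply: (Ts0); apply: Ta; apply: Ts0.
rewrite inE => /andP[/transporterP Tx Mgx]; have Hx := inj_s0 _ Mgx.
have -> : x = (1 - x0 * s0) * x + x0 * (s0 * x).
  by rewrite mulrBl mul1r mulrA subrK.
by apply: left_idealD => //; [apply: Tx | apply: M'M].
Qed.

(** The same comparison for [Hom(S, R / L)] and [Hom(R / L, S)], with
    [S = R / M], along [L' = L :&: M']: when [L] is not inside [M'] one has
    [L + M' = R], so that [R / L'] is the direct sum of [R / L] and the simple
    module [R / M'], and both sides are multiplicative. *)
Lemma card_hom_bigcap M (s : seq {set R}) :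
    maximal_left_ideal M -> all (@maximal_left_ideal R) s ->
  let L := \bigcap_(M' <- s) M' in
  left_ideal L /\
  (#|transporter M L| * #|M| <= #|transporter L M| * #|L|)%N.
Proof.
move=> mM; have lM := maximal_left_ideal_ideal mM.
have [M0 MB MM] := left_idealP _ lM.
elim: s => [_|M' s IHs] /=; first rewrite big_nil; first split.
- exact: left_idealT.
- rewrite mulnC cardsT leq_mul ?max_card // subset_leq_card //.
  by apply/subsetP => x Mx; apply/transporterP => a _; apply: MM.
case/andP=> mM' /IHs[]; rewrite big_cons; set L := \bigcap_(_ <- s) _.
move=> lL IH; have lM' := maximal_left_ideal_ideal mM'.
split; first exact: left_idealI.
have [L0 LB LM] := left_idealP _ lL; have [M'0 M'B M'M] := left_idealP _ lM'.
have [sLM'|/subsetPn[l Ll nM'l]] := boolP (L \subset M').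
  by move/setIidPr: sLM' => ->.
have [b Hb] := maximal_left_ideal_inv mM' nM'l.
have split1 x : exists2 y, y \in L & x - y \in M'.
  exists (x * (b * l)); first by rewrite !LM.
  by rewrite -[x in x - _]mulr1 -mulrBr M'M.
have idB : zmod_morphism (@id R) by [].
have cLM' : (#|L| * #|M'| = #|R| * #|M' :&: L|)%N.
  rewrite (card_additive_sum idB (left_ideal_zmod lL) (left_ideal_zmod lM')).
  congr (_ * _)%N; last by apply: eq_card => x; rewrite !inE andbC.
  rewrite -cardsT; apply: eq_card => x; rewrite inE.
  have [y Ly My] := split1 x; apply/imsetP; exists (y, x - y); first by rewrite inE /= Ly.
  by rewrite /= addrC subrK.
have cT : (#|transporter M L| * #|transporter M M'|
            = #|R| * #|transporter M (M' :&: L)|)%N.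
  rewrite (card_additive_sum idB (transporter_zmod _ lL) (transporter_zmod _ lM')).
  congr (_ * _)%N; last first.
    apply: eq_card => x; rewrite [LHS]inE.
    apply/andP/transporterP => [[/transporterP Tx /transporterP Tx'] a Ma|Tx].
      by rewrite inE Tx' ?Tx.
    by split; apply/transporterP => a /Tx; rewrite inE => /andP[].
  rewrite -cardsT; apply: eq_card => x; rewrite inE.
  have [y Ly My] := split1 x; apply/imsetP; exists (y, x - y).
    rewrite in_setX /=; apply/andP; split; apply/transporterP => a _.
      exact: LM.
    exact: M'M.
  by rewrite /= addrC subrK.
have cU : (#|transporter L M| * #|transporter M' M|
            <= #|transporter (M' :&: L) M| * #|M|)%N.
  rewrite (card_additive_sum idB (transporter_zmod _ lM) (transporter_zmod _ lM)).
  apply: leq_mul; apply: subset_leq_card; apply/subsetP => x.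
    case/imsetP => -[u v]; rewrite in_setX /=.
    case/andP=> /transporterP Tu /transporterP Tv ->.
    apply/transporterP => a; rewrite inE => /andP[M'a La].
    by rewrite mulrDr; apply: left_idealD; [|apply: Tu|apply: Tv].
  rewrite inE => /andP[/transporterP Tx /transporterP Tx'].
  have [y Ly My] := split1 1.
  have -> : x = y * x + (1 - y) * x by rewrite mulrBl mul1r addrC subrK.
  by apply: left_idealD => //; [apply: Tx | apply: Tx'].
have IH' := card_hom_simple mM mM'.
have R0 : (0 < #|R|)%N by apply/card_gt0P; exists 0.
have Mpos : (0 < #|M|)%N by apply/card_gt0P; exists 0.
rewrite -(@leq_pmul2r (#|M| * #|R|)) ?muln_gt0 ?R0 ?Mpos //.
have -> : (#|transporter M (M' :&: L)| * #|M| * (#|M| * #|R|)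
  = (#|transporter M L| * #|M|) * (#|transporter M M'| * #|M|))%N.
  by rewrite [RHS]mulnACA cT; lia.
have -> : (#|transporter (M' :&: L) M| * #|M' :&: L| * (#|M| * #|R|)
  = (#|transporter (M' :&: L) M| * #|M|) * (#|L| * #|M'|))%N.
  by rewrite cLM'; lia.
apply: leq_trans (leq_mul IH IH') _.
by rewrite mulnACA leq_mul2r cU orbT.
Qed.

(** The morphisms from a simple module to [R / Rad R] number at most [#|R / M|]:
    they are no more than those from [R / Rad R] to it, which are given by the
    image of the class of [1]. *)
Lemma card_hom_radical M : maximal_left_ideal M ->
  (#|transporter M [set x in @jacobson_radical R]| * #|M|
     <= #|R| * #|[set x in @jacobson_radical R]|)%N.
Proof.
move=> mM.
pose s := [seq M' <- enum {: {set R}} | maximal_left_ideal M'].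
have eJ : [set x in @jacobson_radical R] = \bigcap_(M' <- s) M'.
  rewrite big_filter big_enum_cond; apply/setP => x.
  rewrite inE; apply/forallP/bigcapP => [Hx M' mM'|Hx M'].
    exact: (implyP (Hx M')).
  by apply/implyP => mM'; apply: Hx.
have [|_ /= le] := @card_hom_bigcap M s mM; first exact: filter_all.
rewrite eJ; apply: leq_trans le _; rewrite leq_mul2r max_card orbT //.
Qed.

(** The right annihilator of [M] is [Hom(R / M, R)].  A nonzero morphism embeds
    the simple module [R / M], so all of them land in the left socle. *)
Lemma rann_maximal_sub_socle M : maximal_left_ideal M ->
  transporter M [set 0] \subset left_socle R.
Proof.
move=> mM; apply/subsetP => r /transporterP Tr.
have lM := maximal_left_ideal_ideal mM; have [M0 MB MM] := left_idealP _ lM.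
have {}Tr a : a \in M -> a * r = 0 by move/Tr; rewrite inE => /eqP.
rewrite inE; apply/existsP.
have [->|r0] := eqVneq r 0.
  exists [ffun => 0]; apply/andP; split; last by rewrite big1 // => I _; rewrite ffunE.
  apply/forallP => I; apply/implyP => /minsetp/andP[/left_idealP[I0 _ _] _].
  by rewrite ffunE.
pose I := [set a * r | a : R].
have lI : left_ideal I.
  apply/left_idealP; split.
  - by apply/imsetP; exists 0; rewrite ?mul0r.
  - by move=> _ _ /imsetP[a _ ->] /imsetP[b _ ->]; apply/imsetP; exists (a - b); rewrite ?mulrBl.
  - by move=> c _ /imsetP[a _ ->]; apply/imsetP; exists (c * a); rewrite ?mulrA.
have Ir : r \in I by apply/imsetP; exists 1; rewrite ?mul1r.
have mI : minimal_left_ideal I.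
  apply/minsetP; split.
    rewrite lI; apply/eqP => e; move: Ir; rewrite e inE; exact/negP.
  move=> J /andP[lJ nJ] sJI; apply/eqP; rewrite eqEsubset sJI /=.
  have [J0 JB JM] := left_idealP _ lJ.
  have [y Jy y0] : exists2 y, y \in J & y != 0.
    apply/exists_inP; apply: contraNT nJ; rewrite negb_exists_in => /forall_inP H.
    rewrite eqEsubset sub1set J0 andbT; apply/subsetP => x /H.
    by rewrite negbK inE.
  have /imsetP[a _ ey] := subsetP sJI y Jy.
  have nMa : a \notin M by apply: contra y0 => /Tr; rewrite -ey => ->.
  have [b Hb] := maximal_left_ideal_inv mM nMa.
  have er : r = b * y.
    by apply/eqP; rewrite ey mulrA -subr_eq0 -[r in r - _]mul1r -mulrBl Tr.
  apply/subsetP => _ /imsetP[c _ ->]; rewrite er; exact: JM (JM _ _ Jy).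
exists [ffun J => if J == I then r else 0]; apply/andP; split.
  apply/forallP => J; apply/implyP => mJ; rewrite ffunE; case: eqP => [->//|_].
  by have /minsetp/andP[/left_idealP[]] := mJ.
rewrite (bigD1 I) //= ffunE eqxx big1 ?addr0 // => J /andP[_ /negPf nJ].
by rewrite ffunE nJ.
Qed.

(** Since the left socle is a copy of [R / Rad R], [Hom(R / M, R)] is
    [Hom(R / M, R / Rad R)]. *)
Lemma card_rann_maximal M :
    radical_quotient_iso_left_socle R -> maximal_left_ideal M ->
  (#|transporter M [set 0%R]| * #|M| <= #|R|)%N.
Proof.
move=> [h [hM hI hS]] mM.
pose J := [set x in @jacobson_radical R].
pose g (x : R) : R := h (\pi_(radical_quotient R) x)%qT.
have gB : zmod_morphism g by move=> x y; rewrite /g !raddfB.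
have g0 x : (g x == 0) = (x \in J).
  rewrite inE /g -[0](raddf0 h) (inj_eq hI) -[0](raddf0 (\pi_(radical_quotient R))%qT).
  by rewrite -Quotient.idealrBE subr0.
have lJ : left_ideal J.
  apply/left_idealP; split.
  - by rewrite -g0 /g !raddf0.
  - by move=> x y; rewrite -!g0 gB => /eqP-> /eqP->; rewrite subrr.
  - by move=> a x; rewrite -!g0 /g hM => /eqP->; rewrite mulr0.
have J_gt0 : (0 < #|J|)%N.
  by apply/card_gt0P; exists 0; case/left_idealP: lJ.
rewrite -(leq_pmul2r J_gt0); apply: leq_trans (card_hom_radical mM).
rewrite mulnAC leq_mul2r; apply/orP; right.
rewrite (card_additive_image gB (transporter_zmod _ lJ)).
apply: leq_mul; apply: subset_leq_card; apply/subsetP => r; last first.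
  move=> Jr; rewrite inE g0 Jr andbT; apply/transporterP => a _.
  by have [_ _ JM] := left_idealP _ lJ; apply: JM.
move=> Tr; have /hS[q eq] := subsetP (rann_maximal_sub_socle mM) r Tr.
move/transporterP: Tr => Tr.
apply/imsetP; exists (repr q); last by rewrite /g reprK.
apply/transporterP => a Ma; rewrite -g0 /g hM reprK eq.
by have := Tr a Ma; rewrite inE.
Qed.

End Ideals.

(** * Cardinality of the dual code *)

Section Duality.
Variables (R : finNzRingType) (n : nat).
Hypothesis socR : radical_quotient_iso_left_socle R.
Implicit Types (C M N : {set 'rV[R]_n}) (u v w s : 'rV[R]_n).

Lemma dotBr w : zmod_morphism (dot w).
Proof.
by move=> u v; rewrite /dot -sumrB; apply: eq_bigr => i _; rewrite !mxE mulrBr.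
Qed.

Lemma dotZl a u v : dot (a *: u) v = a * dot u v.
Proof. by rewrite /dot mulr_sumr; apply: eq_bigr => i _; rewrite mxE mulrA. Qed.

Lemma dot0l u : dot 0 u = 0 :> R.
Proof. by rewrite /dot big1 // => i _; rewrite mxE mul0r. Qed.

Lemma dotDl u v w : dot (u + v) w = dot u w + dot v w.
Proof. by rewrite /dot -big_split; apply: eq_bigr => i _; rewrite mxE mulrDl. Qed.

Lemma dot_delta i u : dot (delta_mx 0 i) u = u 0 i.
Proof.
rewrite /dot (bigD1 i) //= mxE !eqxx mul1r big1 ?addr0 // => j /negPf nji.
by rewrite mxE nji andbF mul0r.
Qed.

Lemma right_dualP C u :
  reflect {in C, forall v, dot v u = 0} (u \in right_dual C).
Proof.
rewrite inE; apply: (iffP forall_inP) => H v Cv; first exact/eqP/H.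
by apply/eqP/H.
Qed.

Lemma right_dual_zmod C : zmod_closed (mem (right_dual C)).
Proof.
split=> [|u v /right_dualP Hu /right_dualP Hv]; apply/right_dualP => w Cw.
  by rewrite /dot big1 // => i _; rewrite mxE mulr0.
by rewrite dotBr Hu ?Hv ?subrr.
Qed.

Lemma left_linear_zmod C : left_linear_code C -> zmod_closed (mem C).
Proof. exact: GRing.submod_closedB. Qed.

Lemma left_linearB C u v : left_linear_code C -> u \in C -> v \in C -> u - v \in C.
Proof. by case/left_linear_zmod => _; apply. Qed.

Lemma left_linearD C u v : left_linear_code C -> u \in C -> v \in C -> u + v \in C.
Proof. by case=> _ CD Cu Cv; rewrite -[u]scale1r; apply: CD. Qed.

Lemma left_linearZ C a u : left_linear_code C -> u \in C -> a *: u \in C.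
Proof. by case=> C0 CD Cu; rewrite -[_ *: _]addr0; apply: CD. Qed.

Lemma left_linearT : left_linear_code [set: 'rV[R]_n].
Proof. by split=> [|a u v _ _]; rewrite inE. Qed.

Lemma left_linear0 : left_linear_code [set (0 : 'rV[R]_n)].
Proof.
split=> [|a u v]; rewrite !inE // => /eqP-> /eqP->.
by rewrite scaler0 addr0.
Qed.

Lemma left_linear_sum M N : left_linear_code M -> left_linear_code N ->
  left_linear_code [set p.1 + p.2 | p in setX M N].
Proof.
move=> lM lN; split.
  apply/imsetP; exists (0, 0); last by rewrite addr0.
  by rewrite in_setX; case: lM => ->; case: lN => ->.
move=> a _ _ /imsetP[[u v] + ->] /imsetP[[u' v'] + ->].
rewrite !in_setX /= => /andP[Mu Nv] /andP[Mu' Nv'].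
apply/imsetP; exists (a *: u + u', a *: v + v'); last first.
  by rewrite /= scalerDr addrACA.
by rewrite in_setX /= !left_linearD ?left_linearZ.
Qed.

Definition adjoin N s : {set 'rV[R]_n} :=
  [set p.1 *: s + p.2 | p in setX [set: R] N].

Lemma adjoinP N s u :
  reflect (exists a, exists2 v, v \in N & u = a *: s + v) (u \in adjoin N s).
Proof.
apply: (iffP imsetP) => [[[a v]]|[a [v Nv ->]]].
  by rewrite in_setX /= => /andP[_ Nv] ->; exists a, v.
by exists (a, v); rewrite // in_setX inE.
Qed.

Lemma adjoin_linear N s : left_linear_code N -> left_linear_code (adjoin N s).
Proof.
move=> lN; split; first by apply/adjoinP; exists 0, 0; [case: lN|rewrite scale0r addr0].
move=> c _ _ /adjoinP[a [v Nv ->]] /adjoinP[b [w Nw ->]].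
apply/adjoinP; exists (c * a + b), (c *: v + w).
  by rewrite left_linearD ?left_linearZ.
by rewrite scalerDr scalerDl scalerA addrACA.
Qed.

Lemma sub_adjoin N s : N \subset adjoin N s.
Proof.
by apply/subsetP => v Nv; apply/adjoinP; exists 0, v; rewrite ?scale0r ?add0r.
Qed.

Lemma mem_adjoin N s : left_linear_code N -> s \in adjoin N s.
Proof.
by case=> N0 _; apply/adjoinP; exists 1, 0; rewrite ?scale1r ?addr0.
Qed.

Lemma adjoin_sub M N s :
  left_linear_code M -> N \subset M -> s \in M -> adjoin N s \subset M.
Proof.
move=> lM sNM Ms; apply/subsetP => _ /adjoinP[a [v Nv ->]].
by apply: left_linearD; [|apply: left_linearZ|apply: (subsetP sNM)].
Qed.

(** A simple step [M / N], generated by [s].  Evaluation at [s] maps [N^perp] to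
    [R] with kernel [M^perp]; its values are annihilated by the left ideal
    [I = {a | a *: s \in N}], which is maximal, so there are at most
    [#|R / I| = #|M / N|] of them. *)
Lemma card_dual_simple M N s :
    left_linear_code N -> s \in M -> s \notin N ->
    {in M :\: N, forall x, M = adjoin N x} ->
  (#|right_dual N| * #|N| <= #|right_dual M| * #|M|)%N.
Proof.
move=> lN Ms nNs simpleMN.
have eM : M = adjoin N s by apply: simpleMN; rewrite inE nNs.
have sNM : N \subset M by rewrite eM sub_adjoin.
pose I := [set a : R | a *: s \in N].
have lI : left_ideal I.
  apply/left_idealP; split=> [|a b|a b]; rewrite !inE.
  - by rewrite scale0r; case: lN.
  - by rewrite scalerBl; apply: left_linearB.
  - by rewrite -scalerA; apply: left_linearZ.
have mI : maximal_left_ideal I.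
  apply/maxsetP; split.
    rewrite lI; apply: contra nNs => /eqP eI.
    have : 1 \in I by rewrite eI inE.
    by rewrite inE scale1r.
  move=> J /andP[lJ nJ] sIJ; apply/eqP; rewrite eqEsubset sIJ andbT.
  apply/subsetP => j Jj; apply/negPn/negP => nIj.
  case/negP: nJ; apply/eqP; apply: left_ideal_eq_setT => //.
  have /adjoinP[b [w Nw es]] : s \in adjoin N (j *: s).
    rewrite -simpleMN // inE; apply/andP; split; first by rewrite inE in nIj.
    rewrite eM; apply/adjoinP; exists j, 0; last by rewrite addr0.
    by case: lN.
  have Ib : 1 - b * j \in I.
    by rewrite inE scalerBl scale1r {1}es scalerA addrC addKr.
  rewrite -[1](subrK (b * j)); apply: left_idealD => //.
    exact: (subsetP sIJ).
  by case/left_idealP: lJ => _ _; apply.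
have cM : (#|R| * #|N| = #|M| * #|I|)%N.
  have sB : zmod_morphism (fun a : R => a *: s) by move=> a b; rewrite scalerBl.
  rewrite -cardsT eM.
  rewrite (card_additive_sum sB (left_ideal_zmod (left_idealT R)) (left_linear_zmod lN)).
  by congr (_ * _)%N; apply: eq_card => a; rewrite !inE.
have cN : (#|right_dual N| = #|dot s @: right_dual N| * #|right_dual M|)%N.
  rewrite (card_additive_image (dotBr s) (right_dual_zmod N)); congr (_ * _)%N.
  apply: eq_card => u; rewrite [LHS]inE.
  apply/andP/right_dualP => [[/right_dualP Nu /eqP su] v|Mu]; last first.
    split; last by rewrite Mu.
    by apply/right_dualP => v Nv; apply: Mu; apply: (subsetP sNM).
  rewrite eM => /adjoinP[b [w Nw ->]].
  by rewrite dotDl dotZl su mulr0 Nu ?addr0.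
have I_gt0 : (0 < #|I|)%N by apply/card_gt0P; exists 0; case/left_idealP: lI.
have cA : (#|dot s @: right_dual N| * #|I| <= #|R|)%N.
  apply: leq_trans (card_rann_maximal socR mI); rewrite leq_mul2r; apply/orP; right.
  apply: subset_leq_card; apply/subsetP => _ /imsetP[u /right_dualP Nu ->].
  by apply/transporterP => a; rewrite !inE => Na; rewrite -dotZl Nu.
rewrite -(leq_pmul2r I_gt0) -[X in (_ <= X)%N]mulnA -cM cN.
have -> : (#|dot s @: right_dual N| * #|right_dual M| * #|N| * #|I|
  = #|right_dual M| * (#|dot s @: right_dual N| * #|I| * #|N|))%N by lia.
by rewrite leq_mul2l leq_mul2r cA !orbT.
Qed.

(** [card_dual_simple] along a chain of codes from [N] to [M]: if some [x]
    does not generate [M] over [N], then [adjoin N x] lies strictly between. *)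
Lemma card_dual_mono M N :
    left_linear_code N -> left_linear_code M -> N \subset M ->
  (#|right_dual N| * #|N| <= #|right_dual M| * #|M|)%N.
Proof.
have [k] := ubnP (#|M| - #|N|); elim: k M N => // k IHk M N le_k lN lM sNM.
have [sMN|/subsetPn[s Ms nNs]] := boolP (M \subset N).
  by have -> : M = N by apply/eqP; rewrite eqEsubset sMN.
have [/forall_inP simple|] := boolP [forall x in M :\: N, M == adjoin N x].
  apply: (@card_dual_simple M N s) => // x Hx; exact/eqP/simple.
rewrite negb_forall_in => /exists_inP[x]; rewrite inE => /andP[nNx Mx] nMP.
have lP := adjoin_linear x lN; have sNP := sub_adjoin N x.
have sPM := adjoin_sub lM sNM Mx.
have ltNP : (#|N| < #|adjoin N x|)%N.
  by apply: proper_card; apply/properP; split=> //; exists x; rewrite ?mem_adjoin.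
have ltPM : (#|adjoin N x| < #|M|)%N.
  by apply: proper_card; rewrite properEneq eq_sym nMP sPM.
apply: (@leq_trans (#|right_dual (adjoin N x)| * #|adjoin N x|)); apply: IHk => //.
- by rewrite -ltnS; apply: leq_trans le_k; rewrite ltnS ltn_sub2r // (ltn_trans ltNP).
- by rewrite -ltnS; apply: leq_trans le_k; rewrite ltnS ltn_sub2l // (ltn_trans ltNP).
Qed.

(** By [card_dual_mono] the product [#|C^perp| * #|C|] lies between its values
    at the zero code and at the full code, and both of these are [#|R| ^ n]. *)
Lemma card_right_dual C : left_linear_code C ->
  (#|right_dual C| * #|C| = #|R| ^ n)%N.
Proof.
move=> lC; have cT : #|[set: 'rV[R]_n]| = (#|R| ^ n)%N.
  by rewrite cardsT card_mx mul1n.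
have C0 : 0 \in C by case: lC.
apply/eqP; rewrite eqn_leq; apply/andP; split.
  apply: leq_trans (card_dual_mono lC left_linearT (subsetT _)) _.
  rewrite cT -[X in (_ <= X)%N]mul1n; apply: leq_mul => //.
  apply: leq_trans (subset_leq_card _) (eq_leq (cards1 (0 : 'rV[R]_n))).
  apply/subsetP => u /right_dualP Hu; rewrite inE; apply/eqP/rowP => i.
  by rewrite -dot_delta Hu ?inE // mxE.
have s0C : [set 0] \subset C by rewrite sub1set.
apply: leq_trans (card_dual_mono left_linear0 lC s0C).
rewrite cards1 muln1 -cT; apply: subset_leq_card; apply/subsetP => u _.
by apply/right_dualP => v; rewrite inE => /eqP->; apply: dot0l.
Qed.

(** The words of [C^perp] supported in [X] form the dual of [C' = C + Q], where
    [Q] consists of the words vanishing on [X], and [#|C'| = #|Q| * #|C \ (E - X)|]. *)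
Lemma card_shortened_dual C (X : {set 'I_n}) : left_linear_code C ->
  (#|[set u in right_dual C | supp u \subset X]| * #|puncture C (~: X)|
    = #|R| ^ #|X|)%N.
Proof.
move=> lC.
pose r := colsub (enum_val (A := mem (~: ~: X))) : 'rV[R]_n -> 'rV[R]_#|~: ~: X|.
have rB : zmod_morphism r by move=> u v; apply/rowP => i; rewrite !mxE.
pose Q := [set v | r v == 0].
have QP v : reflect {in X, forall i, v 0 i = 0} (v \in Q).
  rewrite inE; apply: (iffP eqP) => [e i Xi|Hv].
    have Xi' : i \in ~: ~: X by rewrite setCK.
    by move/rowP/(_ (enum_rank_in Xi' i)): e; rewrite !mxE enum_rankK_in.
  by apply/rowP => j; rewrite !mxE Hv //; have : enum_val j \in ~: ~: X := enum_valP j; rewrite !inE negbK.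
have lQ : left_linear_code Q.
  split=> [|a u v /QP Hu /QP Hv]; apply/QP => i Xi; rewrite !mxE //.
  by rewrite Hu ?Hv // mulr0 addr0.
pose C' := [set p.1 + p.2 | p in setX C Q].
have lC' : left_linear_code C' by apply: left_linear_sum.
have cC : (#|C| = #|puncture C (~: X)| * #|C :&: Q|)%N.
  rewrite (card_additive_image rB (left_linear_zmod lC)); congr (_ * _)%N.
  by apply: eq_card => u; rewrite !inE.
have idB : zmod_morphism (@id 'rV[R]_n) by [].
have cCQ : (#|C| * #|Q| = #|C'| * #|C :&: Q|)%N.
  rewrite (card_additive_sum idB (left_linear_zmod lC) (left_linear_zmod lQ)).
  by congr (_ * _)%N; apply: eq_card => u; rewrite !inE.
have cQ : (#|R| ^ n = #|R| ^ #|X| * #|Q|)%N.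
  have := card_additive_image rB (left_linear_zmod left_linearT).
  rewrite cardsT card_mx mul1n => ->; congr (_ * _)%N; last first.
    by apply: eq_card => u; rewrite !inE.
  have -> : (#|R| ^ #|X| = #|{: 'rV[R]_#|~: ~: X|}|)%N by rewrite card_mx mul1n setCK.
  rewrite -cardsT; apply: eq_card => w; rewrite inE; apply/imsetP.
  exists (\row_i \sum_(j | enum_val j == i) w 0 j); first by rewrite inE.
  apply/rowP => j; rewrite !mxE (big_pred1 j) // => j'.
  by rewrite (inj_eq enum_val_inj).
have dC' : right_dual C' = [set u in right_dual C | supp u \subset X].
  apply/setP => u; rewrite [RHS]inE; apply/right_dualP/andP.
    move=> Hu; split.
      apply/right_dualP => v Cv; apply: Hu; apply/imsetP; exists (v, 0).
        by rewrite in_setX Cv; case: lQ.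
      by rewrite addr0.
    apply/subsetP => i; rewrite inE; apply: contraNT => nXi; apply/eqP.
    rewrite -dot_delta; apply: Hu; apply/imsetP; exists (0, delta_mx 0 i).
      rewrite in_setX /=; apply/andP; split; first by case: lC.
      apply/QP => j Xj; rewrite mxE; case: eqP => //= _; case: eqP => // e.
      by rewrite -e Xj in nXi.
    by rewrite add0r.
  move=> [/right_dualP Hu /subsetP su] _ /imsetP[[v w] + ->].
  rewrite in_setX /= => /andP[Cv /QP Qw]; rewrite dotDl Hu // add0r.
  rewrite /dot big1 // => i _; have [Xi|nXi] := boolP (i \in X).
    by rewrite Qw ?mul0r.
  have := contra (su i) nXi; rewrite inE negbK => /eqP->; exact: mulr0.
have I_gt0 : (0 < #|C :&: Q|)%N.
  by apply/card_gt0P; exists 0; rewrite inE; case: lC => ->; case: lQ => ->.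
have Q_gt0 : (0 < #|Q|)%N by apply/card_gt0P; exists 0; case: lQ.
apply/eqP; rewrite -(eqn_pmul2r Q_gt0) -cQ -(card_right_dual lC') dC' -mulnA.
apply/eqP; congr (_ * _)%N; apply/eqP; rewrite -(eqn_pmul2r I_gt0) mulnAC -cC.
exact/eqP.
Qed.

End Duality.
(** * Harmonic functions *)

Section HarmonicSums.
Variables (K : realType) (n d : nat).
Implicit Types (X Y Z : {set 'I_n}) (f : dspace K n d).

Lemma card_dsubsets_in e X :
  #|[set W : dsubset n e | val W \subset X]| = 'C(#|X|, e).
Proof.
rewrite -cards_draws -(card_imset _ val_inj); apply: eq_card => W.
apply/imsetP/idP => [[w + ->]|]; rewrite !inE; first by rewrite (valP w) andbT.
by case/andP=> sWX cW; exists (Sub W cW); rewrite ?inE SubK.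
Qed.

Lemma ftilde_small f Y : (#|Y| < d)%N -> ftilde f Y = 0.
Proof.
move=> ltYd; rewrite /ftilde big_pred0 // => Z; apply/negP => /subset_leq_card.
by rewrite (eqP (valP Z)) leqNgt ltYd.
Qed.

(** The coefficient of [gamma f] at [W]. *)
Lemma Harm_sum_above f (W : dsubset n d.-1) : (0 < d)%N -> f \in Harm K n d ->
  \sum_(Z : dsubset n d | val W \subset val Z) f Z = 0.
Proof.
move=> d_gt0; rewrite inE => /eqP/(congr1 (fun g : dspace K n d.-1 => g W)).
rewrite /gamma sum_ffunE ffunE => gW; rewrite -[RHS]gW big_mkcond.
apply: eq_bigr => Z _; rewrite /gamma_basis gtn_eqF // ffunE sum_ffunE.
case: ifP => sWZ; last first.
  rewrite big1 ?scaler0 // => Y sYZ; rewrite ffunE; case: eqP => // e.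
  by rewrite e sYZ in sWZ.
rewrite (bigD1 W) //= ffunE eqxx big1 ?addr0 ?[_ *: _]mulr1 // => Y /andP[_ nYW].
by rewrite ffunE eq_sym (negPf nYW).
Qed.

(** One-point extensions of [Y] containing [Z], against the [(d - 1)]-subsets of
    [Z] inside [Y].  If [Z] lies in [Y], all [#|~: Y|] points and [d] subsets
    qualify; if [Z] has one point outside [Y], exactly one of each; otherwise
    none. *)
Lemma card_one_point_extensions Y Z : (0 < d)%N -> #|Z| = d ->
  (#|[set a in ~: Y | Z \subset a |: Y]| + d * (Z \subset Y)
    = #|~: Y| * (Z \subset Y) + 'C(#|Z :&: Y|, d.-1))%N.
Proof.
move=> d_gt0 cZ; have := cardsID Y Z; rewrite cZ => eZ.
have ext a : (Z \subset a |: Y) = (Z :\: Y \subset [set a]).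
  by rewrite subDset setUC.
have [sZY|nsZY] := boolP (Z \subset Y).
  rewrite (setIidPl sZY) cZ !muln1 -[X in 'C(X, _)](prednK d_gt0) binSn prednK //.
  congr (_ + _)%N; apply: eq_card => a; rewrite inE ext.
  by move: sZY; rewrite -setD_eq0 => /eqP->; rewrite sub0set andbT.
rewrite !muln0 addn0 add0n.
have D_gt0 : (0 < #|Z :\: Y|)%N by rewrite card_gt0 setD_eq0.
have [/cards1P[b eb]|D1] := boolP (#|Z :\: Y| == 1%N).
  have -> : #|Z :&: Y| = d.-1 by rewrite -eZ eb cards1 addn1.
  rewrite binn; apply/eqP/cards1P; exists b; apply/setP => a.
  rewrite !inE ext eb sub1set inE eq_sym andb_idl // => /eqP->.
  by have := set11 b; rewrite -eb inE => /andP[].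
rewrite bin_small; last by move: D1 D_gt0 eZ; lia.
apply/eqP; rewrite cards_eq0; apply/eqP/setP => a; rewrite !inE ext.
apply/negP => /andP[_ /subset_leq_card]; rewrite cards1 => D2.
by rewrite eqn_leq D2 D_gt0 in D1.
Qed.

(** Summing [gamma f = 0] over the [(d - 1)]-subsets of [Y] expresses the sum of
    [f] over the sets [Z] with [#|Z :\: Y| = 1] as [- d * ftilde f Y]. *)
Lemma Harm_sum_one_point f Y : f \in Harm K n d ->
  \sum_(a in ~: Y) ftilde f (a |: Y) = (#|~: Y|%:R - d%:R) * ftilde f Y.
Proof.
move=> Hf; rewrite /ftilde.
rewrite (exchange_big_dep predT) //=.
have -> : (#|~: Y|%:R - d%:R) * (\sum_(Z : dsubset n d | val Z \subset Y) f Z)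
  = \sum_(Z : dsubset n d) f Z * (#|~: Y| * (val Z \subset Y))%:R
    - \sum_(Z : dsubset n d) f Z * (d * (val Z \subset Y))%:R.
  rewrite -sumrB mulr_sumr big_mkcond; apply: eq_bigr => Z _.
  by case: ifP => _; rewrite ?muln1 ?muln0 ?subrr // mulrC mulrBr.
under eq_bigr => Z _.
  have -> : \sum_(a in ~: Y | val Z \subset a |: Y) f Z
    = f Z * #|[set a in ~: Y | val Z \subset a |: Y]|%:R.
    rewrite -sum1_card natr_sum mulr_sumr.
    by apply: eq_big => a; rewrite ?inE ?mulr1.
  over.
have [d0|d_gt0] := posnP d.
  rewrite [X in _ - X]big1 ?subr0; last by move=> Z _; rewrite [X in (X * _)%N]d0 mulr0.
  apply: eq_bigr => Z _; have Z0 : val Z = set0.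
    by apply/eqP; rewrite -cards_eq0 (eqP (valP Z)); apply/eqP.
  rewrite Z0 sub0set muln1; congr (_ * _%:R); apply: eq_card => a.
  by rewrite inE sub0set andbT.
apply/eqP; rewrite -subr_eq0 opprD opprK addrA addrAC -big_split -sumrB /=.
under eq_bigr => Z _.
  rewrite -mulrDr -natrD card_one_point_extensions ?(eqP (valP Z)) //.
  rewrite natrD mulrDr addrC addKr -card_dsubsets_in.
  have -> : f Z * #|[set W : dsubset n d.-1 | val W \subset val Z :&: Y]|%:R
    = \sum_(W : dsubset n d.-1 | (val W \subset val Z) && (val W \subset Y)) f Z.
    rewrite -sum1_card natr_sum mulr_sumr.
    by apply: eq_big => W; rewrite ?inE ?subsetI ?mulr1.
  over.
rewrite (exchange_big_dep (fun W : dsubset n d.-1 => val W \subset Y)) /=; last first.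
  by move=> Z W _ /andP[].
apply/eqP; rewrite big1 // => W sWY; rewrite -[RHS](Harm_sum_above W d_gt0 Hf).
by apply: eq_bigl => Z; rewrite sWY andbT.
Qed.

(** Counting the pairs [(X, a |: X)] with [#|X| = #|Y| + i] in two ways turns
    the one-point case into the recursion of the binomial coefficients. *)
Lemma Harm_sum_above_card f Y i : f \in Harm K n d -> (d + #|Y| <= n)%N ->
  \sum_(X : {set 'I_n} | (Y \subset X) && (#|X| == #|Y| + i)%N) ftilde f X
    = 'C(n - d - #|Y|, i)%:R * ftilde f Y.
Proof.
move=> Hf le_n; elim: i => [|i IHi].
  rewrite bin0 mul1r (big_pred1 Y) // => X.
  rewrite addn0 [RHS]eq_sym [RHS]eqEcard; case sYX: (Y \subset X) => //=.
  by rewrite eqn_leq (subset_leq_card sYX) andbT.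
set N := (n - d - #|Y|)%N in IHi *.
pose S j := \sum_(X : {set 'I_n} | (Y \subset X) && (#|X| == #|Y| + j)%N) ftilde f X.
have rec : i.+1%:R * S i.+1 = (n%:R - d%:R - #|Y|%:R - i%:R) * S i.
  rewrite /S !mulr_sumr.
  transitivity (\sum_(X : {set 'I_n} | (Y \subset X) && (#|X| == #|Y| + i)%N)
      \sum_(a in ~: X) ftilde f (a |: X)); last first.
    apply: eq_bigr => X /andP[_ /eqP cX]; rewrite Harm_sum_one_point //.
    have := cardsC X; rewrite card_ord => /(congr1 (fun k => k%:R : K)).
    by rewrite natrD cX natrD => e; congr (_ * _); rewrite -e; ring.
  (* X now plays the part of the larger set a |: X. *)
  transitivity (\sum_(X : {set 'I_n} | (Y \subset X) && (#|X| == #|Y| + i.+1)%N)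
      \sum_(a in X :\: Y) ftilde f X).
    apply: eq_bigr => X /andP[sYX /eqP cX]; rewrite sumr_const.
    by rewrite mulr_natl cardsD (setIidPr sYX) cX addKn.
  rewrite (exchange_big_dep predT) //= [RHS](exchange_big_dep predT) //=.
  apply: eq_bigr => a _.
  rewrite (reindex_onto (fun X => a |: X) (fun X => X :\ a)) /=; last first.
    by move=> X /andP[_]; rewrite inE => /andP[_ aX]; rewrite setD1K.
  apply: eq_bigl => X; rewrite !inE eqxx /= andbT.
  have [aX|aX] /= := boolP (a \in X).
    rewrite andbF; apply/negP => /andP[_ /eqP e].
    by move: aX; rewrite -e !inE eqxx.
  rewrite setU1K // eqxx !andbT cardsU1 aX add1n addnS eqSS -andbA.
  rewrite -subDset; have [aY|aY] := boolP (a \in Y); rewrite ?andbF ?andbT.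
    by symmetry; apply/negP => /andP[/subsetP/(_ a aY)]; rewrite (negPf aX).
  congr (_ && _); suff -> : Y :\ a = Y by []; apply/setP => b; rewrite !inE.
  by case: eqP => //= ->; rewrite (negPf aY).
have i_neq0 : i.+1%:R != 0 :> K by rewrite pnatr_eq0.
apply: (mulfI i_neq0); rewrite -/(S i.+1) rec /S IHi !mulrA -!natrM mul_bin_left.
have [le_iN|lt_Ni] := leqP i N; last by rewrite bin_small // muln0 mulr0.
congr (_ * _); rewrite natrM natrB // /N !natrB //; lia.
Qed.

(** The local form of the theorem: the binomial expansion of
    [x = (x - y) + y], with the coefficients of [Harm_sum_above_card]. *)
Lemma Harm_local_expansion f Y (x y : {poly {poly K}}) :
    (d <= n)%N -> f \in Harm K n d ->
  \sum_(X : {set 'I_n} | (d <= #|X| <= n - d)%N && (Y \subset X))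
      (ftilde f X)%:P%:P * ((x - y) ^+ (#|~: X| - d) * y ^+ (#|X| - d))
    = if (d <= #|Y| <= n - d)%N
      then (ftilde f Y)%:P%:P * (x ^+ (#|~: Y| - d) * y ^+ (#|Y| - d)) else 0.
Proof.
move=> le_dn Hf; have cC X : #|~: X| = (n - #|X|)%N by rewrite cardsCs setCK card_ord.
have [leY|ltY] := leqP #|Y| (n - d); last first.
  rewrite andbF big_pred0 // => X; apply/negP => /andP[/andP[_ leX]].
  by move/subset_leq_card; rewrite leqNgt (leq_ltn_trans leX).
have le_n : (d + #|Y| <= n)%N by lia.
pose N := (n - d - #|Y|)%N.
(* Group the X above Y by i = #|X| - #|Y|; if #|Y| < d, small i are excluded
   but every term vanishes. *)
have -> : \sum_(X : {set 'I_n} | (d <= #|X| <= n - d)%N && (Y \subset X))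
      (ftilde f X)%:P%:P * ((x - y) ^+ (#|~: X| - d) * y ^+ (#|X| - d))
  = \sum_(i < N.+1) (if (d <= #|Y| + i)%N then
       ('C(N, i)%:R * ftilde f Y)%:P%:P * ((x - y) ^+ (N - i) * y ^+ (#|Y| + i - d))
       else 0).
  rewrite (partition_big (fun X : {set 'I_n} => inord (#|X| - #|Y|) : 'I_N.+1) predT) //=.
  apply: eq_bigr => i _.
  have eqi X : Y \subset X -> (#|X| <= n - d)%N ->
      (inord (#|X| - #|Y|) == i :> 'I_N.+1) = (#|X| == #|Y| + i)%N.
    move=> /subset_leq_card leYX leX; rewrite -val_eqE /= inordK; last by rewrite ltnS leq_sub2r.
    by rewrite -(eqn_add2l #|Y|) subnKC.
  case: ifP => [led|ltd]; last first.
    rewrite big_pred0 // => X; apply/negP => /andP[/andP[/andP[leX1 leX2] sYX]].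
    by rewrite eqi // => /eqP eX; rewrite -eX leX1 in ltd.
  rewrite -Harm_sum_above_card // !rmorph_sum mulr_suml /=.
  apply: eq_big => [X|X].
    have [sYX|] := boolP (Y \subset X); rewrite ?andbF //= andbT.
    have [leX|ltX] := leqP #|X| (n - d).
      by rewrite eqi // andbT; apply: andb_idl => /eqP->.
    rewrite andbF /=; symmetry; apply/negP => /eqP eX.
    by move: ltX; rewrite eX ltnNge -leq_subRL // -ltnS ltn_ord.
  move=> /andP[/andP[/andP[leX1 leX2] sYX]]; rewrite eqi // => /eqP eX.
  by rewrite cC eX; rewrite subnAC subnDA.
case: ifP => [/andP[leY1 _]|]; last first.
  rewrite andbT => /negbT; rewrite -ltnNge => ltYd.
  by rewrite big1 // => i _; case: ifP => // _; rewrite ftilde_small // mulr0 !polyC0 mul0r.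
have -> : (#|~: Y| - d = N)%N by rewrite cC subnAC.
rewrite -[x in RHS](subrK y) exprDn !(mulr_suml, mulr_sumr); apply: eq_bigr => i _.
rewrite (leq_trans leY1) ?leq_addr // -addnBAC // exprD !rmorphM /= !rmorph_nat.
rewrite -mulr_natl; ring.
Qed.

End HarmonicSums.

(** * The harmonic weight enumerator of the dual code *)

(** Splitting the [m]-tuples of words of [B] supported in [X] according to
    their exact joint support. *)
Lemma sum_tuple_support_count (R : finNzRingType) n m (B : {set 'rV[R]_n})
    (X : {set 'I_n}) :
  (\sum_(Y : {set 'I_n} | Y \subset X) tuple_support_count m B Y
    = #|[set u in B | supp u \subset X]| ^ m)%N.
Proof.
set D := [set u in B | _].
rewrite -[in RHS](card_ord m) -card_ffun_on -sum1_card.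
rewrite (partition_big (fun u : {ffun 'I_m -> 'rV[R]_n} => \bigcup_i supp (u i))
           (fun Y => Y \subset X)) /=.
  apply: eq_bigr => Y sYX; rewrite sum1_card; apply: eq_card => u.
  rewrite !inE [RHS]unfold_in /=.
  apply/andP/andP => -[Hu /eqP eY]; rewrite eY eqxx; split=> //.
    apply/ffun_onP => i; rewrite inE (forallP Hu) /=.
    by apply: subset_trans sYX; rewrite -eY; exact: (bigcup_sup i).
  by apply/forallP => i; have /ffun_onP/(_ i) := Hu; rewrite inE => /andP[].
move=> u /ffun_onP Hu; apply/bigcupsP => i _.
by have := Hu i; rewrite inE => /andP[].
Qed.

(** The exponent of the theorem: with [card_shortened_dual], it makes
    [(#|R| ^+ m) `^ (#|X| - alpha X)] the number of [m]-tuples of words of the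
    dual code supported in [X]. *)
Lemma powR_alpha (K : realType) (R : finNzRingType) n d m (C : {set 'rV[R]_n})
    (X : {set 'I_n}) :
    radical_quotient_iso_left_socle R -> left_linear_code C -> (d <= #|X|)%N ->
  ((#|R|%:R ^+ m) `^ (d%:R - alpha K C X)) * (#|R|%:R ^+ m) ^+ (#|X| - d)
    = (#|[set u in right_dual C | supp u \subset X]| ^ m)%:R :> K.
Proof.
move=> socR lC le_d.
have := card_shortened_dual socR X lC; set S := #|[set u in _ | _]|.
rewrite /alpha; set D := #|puncture C (~: X)| => cSD.
have R_gt1 : (1 < #|R|)%N.
  by apply/card_gt1P; exists 0, 1; rewrite ?inE // eq_sym oner_neq0.
have D_gt0 : (0 < D)%N.
  by apply/card_gt0P; exists (colsub (enum_val (A := mem (~: ~: X))) 0); apply: imset_f; case: lC.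
have q_gt0 : 0 < #|R|%:R :> K by rewrite ltr0n (ltn_trans _ R_gt1).
have lnq : ln #|R|%:R != 0 :> K by rewrite gt_eqF // ln_gt0 // ltr1n.
have DK : D%:R != 0 :> K by rewrite pnatr_eq0 -lt0n.
have pD : (#|R|%:R ^+ m) `^ (ln D%:R / ln #|R|%:R) = D%:R ^+ m :> K.
  rewrite /powR gt_eqF ?exprn_gt0 // lnXn // mulrnAr divfK //.
  by rewrite -mulr_natl expRM_natl lnK // posrE ltr0n.
rewrite powRB ?pD ?powR_mulrn ?exprn_ge0 1?ltW //; last first.
  by rewrite expf_neq0 ?implybT // gt_eqF.
apply: (mulIf (expf_neq0 m DK)); rewrite mulrAC divfK ?expf_neq0 //.
rewrite -exprD subnKC // natrX -exprMn -natrM cSD natrX -!exprM.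
by rewrite mulnC.
Qed.

Theorem theorem3p3 (K : realType) (R : finNzRingType) (n d m : nat)
    (C : {set 'rV[R]_n}) (f : dspace K n d) :
  frobenius_ring R ->
  (d <= n)%N ->
  (1 <= m)%N ->
  left_linear_code C ->
  f \in Harm K n d ->
  harm_Z m (right_dual C) f =
  \sum_(X : {set 'I_n} | (d <= #|X| <= n - d)%N)
     (ftilde f X * (#|R|%:R ^+ m) `^ (d%:R - alpha K C X))%:P%:P
     * ('X - 'Y) ^+ (#|~: X| - d)
     * (#|R|%:R ^+ m * 'Y) ^+ (#|X| - d).
Proof.
move=> [_ socR] le_dn _ lC Hf; set B := right_dual C.
pose T (X : {set 'I_n}) : {poly {poly K}} :=
  (ftilde f X)%:P%:P * (('X - 'Y) ^+ (#|~: X| - d) * 'Y ^+ (#|X| - d)).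
transitivity (\sum_(X : {set 'I_n} | (d <= #|X| <= n - d)%N)
    \sum_(Y : {set 'I_n} | Y \subset X) (tuple_support_count m B Y)%:R * T X);
  last first.
  apply: eq_bigr => X /andP[le_d _].
  rewrite -mulr_suml -natr_sum sum_tuple_support_count.
  have := powR_alpha K m socR lC le_d; rewrite -/B => e.
  rewrite -[_%:R](rmorph_nat (polyC \o polyC)) -e /T /= !(rmorphM, rmorphXn) /=.
  rewrite exprMn !rmorph_nat; ring.
rewrite (exchange_big_dep predT) //= /harm_Z.
under [RHS]eq_bigr => Y _ do rewrite -mulr_sumr Harm_local_expansion //.
rewrite [LHS]big_mkcond; apply: eq_bigr => Y _; case: ifP => _; last by rewrite mulr0.
rewrite !rmorphM /= !rmorph_nat; ring.
Qed.
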